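(* Let $m\ge 3$ be an integer or $m=\infty$. The algorithm $\mathsf{A}$ described in the context solves $(L_m)$ with approximation ratio $c_4(m)\,\delta^{\frac{d-2}{2}}\left(\prod_{k=1}^{d-2}\frac{\ln n_k}{n_k}\right)^{\frac12}$; that is, for any given $\epsilon>0$ and $\delta\in(0,\frac{1}{16})$, it generates in polynomial time, with probability at least $1-\epsilon$, a feasible solution $(\boldsymbol{y}^1,\boldsymbol{y}^2,\dots,\boldsymbol{y}^d)$ of $(L_m)$ such that $$\mathrm{Re}\,F(\boldsymbol{y}^1,\boldsymbol{y}^2,\dots,\boldsymbol{y}^d)\ge c_4(m)\,\delta^{\frac{d-2}{2}}\left(\prod_{k=1}^{d-2}\frac{\ln n_k}{n_k}\right)^{\frac12}v_{\max}(L_m).$$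
   Context: For an integer $m$, $\mathbf{\Omega}_m=\{1,\omega_m,\dots,\omega_m^{m-1}\}$ with $\omega_m=e^{\mathbf{i}2\pi/m}$; $\mathbf{\Omega}_\infty=\{z\in\mathbb{C}:|z|=1\}$; $\mathbf{\Omega}_m^n$ is the set of vectors in $\mathbb{C}^n$ with all entries in $\mathbf{\Omega}_m$. Given a complex tensor $\mathcal{F}\in\mathbb{C}^{n_1\times n_2\times\dots\times n_d}$ of order $d\ge 2$, with $n_1\le n_2\le\dots\le n_d$, its multilinear form is $F(\boldsymbol{x}^1,\dots,\boldsymbol{x}^d)=\sum_{i_1=1}^{n_1}\cdots\sum_{i_d=1}^{n_d}\mathcal{F}_{i_1\dots i_d}x^1_{i_1}\cdots x^d_{i_d}$. The problem $(L_m)$ is $$\max\ \mathrm{Re}\,F(\boldsymbol{x}^1,\dots,\boldsymbol{x}^d)\quad\text{s.t. }\boldsymbol{x}^k\in\mathbf{\Omega}_m^{n_k},\ k=1,\dots,d,$$ and $v_{\max}(L_m)$ is its optimal value. The order $d$ is regarded as fixed in ''polynomial time''. Constants. $c_4(m)=0.7118\cos^2\frac{\pi}{m}$ for integer $m$, and $c_4(\infty)=0.7118$. $c_2(m)=\min\{k\ge2:k\text{ is a divisor of }m\}$ for integer $m$, and $c_2(\infty)=2$. For $\delta\in(0,\frac1{16})$, $c_1(\delta)>0$ is a constant depending only on $\delta$ such that for all $n$, all integers $m\ge3$ or $m=\infty$, and all $\boldsymbol{a}\in\mathbb{C}^n$, if $\boldsymbol{\xi}\in\mathbb{C}^n$ has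 i.i.d. entries uniform on $\mathbf{\Omega}_m$, then $\mathrm{Prob}\{\mathrm{Re}(\boldsymbol{a}^{\mathrm T}\boldsymbol{\xi})\ge\sqrt{\delta\ln n/n}\,\|\boldsymbol{a}\|_1\}\ge\frac{c_1(\delta)}{c_2(m)n^{5\delta}}$ (such a constant exists). Subroutine (known result of Huang and Zhang, used as a black box). For bilinear problems ($d=2$) $\max\{\mathrm{Re}\,B(\boldsymbol{x},\boldsymbol{y}):\boldsymbol{x}\in\mathbf{\Omega}_m^{p},\boldsymbol{y}\in\mathbf{\Omega}_m^{q}\}$ there is a polynomial-time (randomized) algorithm returning a feasible solution whose objective value is at least $c_4(m)$ times the optimal value. Algorithm $\mathsf{A}$ (inputs $\mathcal{F}$, $m$, $\epsilon>0$, $\delta\in(0,\frac1{16})$): 1. Randomly generate $\boldsymbol{\xi}^k\in\mathbf{\Omega}_m^{n_k}$ for $k=1,\dots,d-2$, where all entries $\xi^k_i$ are i.i.d. uniform on $\mathbf{\Omega}_m$. 2. Apply the subroutine to the bilinear problem $\max\ \mathrm{Re}\,F(\boldsymbol{\xi}^1,\dots,\boldsymbol{\xi}^{d-2},\boldsymbol{x}^{d-1},\boldsymbol{x}^d)$ s.t. $\boldsymbol{x}^{d-1}\in\mathbf{\Omega}_m^{n_{d-1}},\boldsymbol{x}^d\in\mathbf{\Omega}_m^{n_d}$, obtaining an approximate solution $(\boldsymbol{\xi}^{d-1},\boldsymbol{\xi}^d)$. 3. Compute the objective value $\mathrm{Re}\,F(\boldsymbol{\xi}^1,\dots,\boldsymbol{\xi}^d)$.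 4. Repeat independently the whole procedure of randomly generating $\boldsymbol{\xi}^1,\dots,\boldsymbol{\xi}^{d-2}$, applying the subroutine to the resulting bilinear problem to obtain $(\boldsymbol{\xi}^{d-1},\boldsymbol{\xi}^d)$, and computing the objective value $\mathrm{Re}\,F(\boldsymbol{\xi}^1,\dots,\boldsymbol{\xi}^d)$, $\ln\frac1\epsilon\left(\frac{c_2(m)}{c_1(\delta)}\right)^{d-2}\prod_{k=1}^{d-2}n_k^{5\delta}$ times (rounded up to an integer), and output a solution with the largest objective value. *)

(* Defs.v *)
From HB Require Import structures.
From mathcomp Require Import all_boot all_order all_algebra.
From mathcomp Require Import all_classical all_reals all_analysis.
From mathcomp Require Import complex.

Set Implicit Arguments.
Unset Strict Implicit.
Unset Printing Implicit Defensive.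

Import Order.TTheory GRing.Theory Num.Theory.

Local Open Scope classical_set_scope.
Local Open Scope complex_scope.
Local Open Scope ring_scope.

Variant modulus := Fin of nat | Infty.

Definition admissible (m : modulus) : bool :=
  if m is Fin k then (3 <= k)%N else true.

Definition expi (R : realType) (t : R) : R[i] := cos t +i* sin t.

Definition omega (R : realType) (m : nat) : R[i] := expi (2 * pi / m%:R).

Definition Omega (R : realType) (m : modulus) : set R[i] :=
  match m with
  | Fin k => [set omega R k ^+ j | j in [set j : nat | (j < k)%N]]
  | Infty => [set z | `|z| = 1]
  end.

Definition c2 (m : modulus) : nat :=
  if m is Fin k then
    [arg min_(j < ord_max : 'I_k.+1 | (2 <= j)%N && (j %| k)%N) (j : nat)]
  else 2%N.

Definition c4 (R : realType) (m : modulus) : R :=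
  if m is Fin k then 7118 / 10 ^+ 4 * cos (pi / k%:R) ^+ 2 else 7118 / 10 ^+ 4.

(* The Borel sets of R[i], identified with R * R. *)
Definition cborel (R : realType) : set (set R[i]) :=
  [set A | measurable [set p : R * R | A (p.1 +i* p.2)]].

Lemma two_pi_gt0 (R : realType) : (0 : R) < 2 * pi.
Proof. by rewrite mulr_gt0 ?pi_gt0. Qed.

(* On the unit circle, the law of expi t for t uniform on [0, 2 pi]. *)
Definition uniform_Omega (R : realType) (m : modulus) (A : set R[i]) : \bar R :=
  match m with
  | Fin k => ((\sum_(j < k) \1_A (omega R k ^+ j)) / k%:R)%:E
  | Infty => uniform_prob (two_pi_gt0 R) (@expi R @^-1` A)
  end.

Definition uniform_on (R : realType) (dT : measure_display)
    (T : measurableType dT) (P : probability T R) (m : modulus)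
    (X : T -> R[i]) : Prop :=
  forall A, cborel A ->
    measurable (X @^-1` A) /\ P (X @^-1` A) = uniform_Omega m A.

Definition mutually_independent (R : realType) (dT : measure_display)
    (T : measurableType dT) (P : probability T R) (I : finType)
    (G : I -> set (set T)) : Prop :=
  forall (J : {set I}) (A : I -> set T), (forall i, i \in J -> G i (A i)) ->
    P (\bigcap_(i in [set` J]) A i) = (\prod_(i in J) P (A i))%E.

Definition iid_uniform (R : realType) (dT : measure_display)
    (T : measurableType dT) (P : probability T R) (m : modulus) (I : finType)
    (xi : I -> T -> R[i]) : Prop :=
  (forall i, uniform_on P m (xi i)) /\
  mutually_independent P (fun i => preimage_set_system setT (xi i) (@cborel R)).

(* "P (S) >= p" for an event S that is not known to be measurable: S contains
   a measurable event of probability at least p. *)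
Definition prob_ge (R : realType) (dT : measure_display)
    (T : measurableType dT) (P : probability T R) (S : set T) (p : R) : Prop :=
  exists E : set T, [/\ measurable E, E `<=` S & (p%:E <= P E)%E].

Definition c1_spec (R : realType) (c1 : R -> R) : Prop :=
  forall delta : R, 0 < delta < 16^-1 ->
    0 < c1 delta /\
    forall (n : nat) (m : modulus) (a : 'cV[R[i]]_n),
      (0 < n)%N -> admissible m ->
      forall (dT : measure_display) (T : measurableType dT)
        (P : probability T R) (xi : 'I_n -> T -> R[i]),
        iid_uniform P m xi ->
        let bound := Num.sqrt (delta * ln n%:R / n%:R) *
                     (\sum_i complex.Re `|a i 0|) in
        ((c1 delta / ((c2 m)%:R * n%:R `^ (5 * delta)))%:E <=
         P [set w | bound <= complex.Re (\sum_i a i 0 * xi i w)]%R)%E.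

Notation midx n := {dffun forall k, 'I_(n k)}.

Definition vecs (R : realType) (d : nat) (n : 'I_d -> nat) :=
  forall k : 'I_d, 'cV[R[i]]_(n k).

Definition mlform (R : realType) (d : nat) (n : 'I_d -> nat)
    (F : midx n -> R[i]) (x : vecs R n) : R[i] :=
  \sum_(i : midx n) F i * \prod_(k < d) x k (i k) 0.

Definition Omega_vec (R : realType) (m : modulus) (p : nat)
    (x : 'cV[R[i]]_p) : Prop :=
  forall i, Omega m (x i 0).

Definition feasible (R : realType) (m : modulus) (d : nat) (n : 'I_d -> nat)
    (x : vecs R n) : Prop :=
  forall k, Omega_vec m (x k).

Definition vmax (R : realType) (m : modulus) (d : nat) (n : 'I_d -> nat)
    (F : midx n -> R[i]) : R :=
  sup [set complex.Re (mlform F x) | x in @feasible R m d n].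

(* Real-RAM model: a computation is its result together with the number of
   unit-cost steps it has used, a step being an arithmetic operation or an
   elementary function on scalars, a comparison, a memory write, an iteration
   of a loop or the generation of one random entry. *)
Definition timed (A : Type) : Type := (A * nat)%type.

Definition charge (A : Type) (t : nat) (a : A) : timed A := (a, t).

Definition tret (A : Type) (a : A) : timed A := charge 0 a.

Definition tstep (A : Type) (a : A) : timed A := charge 1 a.

Definition tbind (A B : Type) (c : timed A) (f : A -> timed B) : timed B :=
  charge (c.2 + (f c.1).2) (f c.1).1.

Notation "'let!' x := c 'in' e" := (tbind c (fun x => e))
  (at level 200, x name, c at level 100, e at level 200).

Fixpoint tloop (I A : Type) (s : seq I) (body : I -> A -> timed A) (a : A) :
    timed A :=
  if s is i :: s' then
    let! _ := tstep tt in
    let! a' := body i a in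
    tloop s' body a'
  else tret a.

Definition biform (R : realType) (p q : nat) (B : 'M[R[i]]_(p, q))
    (x : 'cV[R[i]]_p) (y : 'cV[R[i]]_q) : R[i] :=
  \sum_i \sum_j B i j * x i 0 * y j 0.

(* The last argument, in S, stands for the internal random choices. *)
Definition bilinear_algorithm (R : realType) (S : Type) :=
  forall p q : nat, 'M[R[i]]_(p, q) -> S -> timed ('cV[R[i]]_p * 'cV[R[i]]_q).

Definition bilinear_approx (R : realType) (S : Type) (m : modulus)
    (sub : bilinear_algorithm R S) : Prop :=
  forall (p q : nat) (B : 'M[R[i]]_(p, q)) (s : S), (0 < p)%N -> (0 < q)%N ->
    let xy := (sub p q B s).1 in
    [/\ Omega_vec m xy.1, Omega_vec m xy.2 &
        c4 R m * sup [set complex.Re (biform B uv.1 uv.2) | uv in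
                       [set uv | Omega_vec m uv.1 /\ Omega_vec m uv.2]]
          <= complex.Re (biform B xy.1 xy.2)].

Definition bilinear_polytime (R : realType) (S : Type)
    (sub : bilinear_algorithm R S) : Prop :=
  exists f : {poly R},
    forall (p q : nat) (B : 'M[R[i]]_(p, q)) (s : S), (0 < p)%N -> (0 < q)%N ->
      ((sub p q B s).2)%:R <= f.[(p * q)%:R].

Lemma penult_subproof (d : nat) : (2 <= d)%N -> (d - 2 < d)%N.
Proof. by case: d => [|d] // _; rewrite ltn_subrL. Qed.

Lemma ultim_subproof (d : nat) : (2 <= d)%N -> (d - 1 < d)%N.
Proof. by case: d => [|d] // _; rewrite ltn_subrL. Qed.

(* Modes are numbered from 0: the random modes are 0, ..., d - 3, and the two
   modes left to the subroutine are d - 2 and d - 1. *)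
Definition penult (d : nat) (hd : (2 <= d)%N) : 'I_d :=
  Ordinal (penult_subproof hd).

Definition ultim (d : nat) (hd : (2 <= d)%N) : 'I_d :=
  Ordinal (ultim_subproof hd).

Definition lead_modes (d : nat) : seq 'I_d :=
  [seq k : 'I_d <- enum 'I_d | (k < d - 2)%N].

(* The positions of the entries of xi^1, ..., xi^(d-2). *)
Notation lead_pos d n :=
  {u : {k : 'I_d & 'I_(n k)} | (tag u < d - 2)%N}.

(* The vectors xi^1, ..., xi^(d-2), padded with null vectors. *)
Definition lead_vecs (R : realType) (d : nat) (n : 'I_d -> nat)
    (xi : lead_pos d n -> R[i]) : vecs R n :=
  fun k => \col_j
    if insub (Tagged (fun k => 'I_(n k)) j) is Some u then xi u else 0.

Definition monomial (R : realType) (d : nat) (n : 'I_d -> nat) (x : vecs R n)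
    (i : midx n) (ks : seq 'I_d) (c : R[i]) : timed R[i] :=
  tloop ks (fun k c => tstep (c * x k (i k) 0)) c.

(* The matrix of the bilinear form F (xi^1, ..., xi^(d-2), _, _). Adding a
   multiple of delta_mx changes a single entry, hence costs one addition and
   one memory write. *)
Definition contract (R : realType) (d : nat) (hd : (2 <= d)%N)
    (n : 'I_d -> nat) (F : midx n -> R[i]) (x : vecs R n) :
    timed 'M[R[i]]_(n (penult hd), n (ultim hd)) :=
  let! B0 := charge (n (penult hd) * n (ultim hd)) 0 in
  tloop (enum {: midx n})
    (fun i B =>
       let! c := monomial x i (lead_modes d) (F i) in
       charge 2 (B + c *: delta_mx (i (penult hd)) (i (ultim hd))))
    B0.

Definition objective (R : realType) (d : nat) (n : 'I_d -> nat)
    (F : midx n -> R[i]) (x : vecs R n) : timed R :=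
  let! v := tloop (enum {: midx n})
    (fun i v =>
       let! c := monomial x i (enum 'I_d) (F i) in
       tstep (v + c))
    0 in
  tstep (complex.Re v).

Definition trial (R : realType) (S : Type) (sub : bilinear_algorithm R S)
    (d : nat) (hd : (2 <= d)%N) (n : 'I_d -> nat) (F : midx n -> R[i])
    (xi : lead_pos d n -> R[i]) (s : S) : timed (vecs R n * R) :=
  let! x := charge #|{: lead_pos d n}| (lead_vecs xi) in
  let! B := contract hd F x in
  let! yz := sub _ _ B s in
  let! x := charge (n (penult hd) + n (ultim hd))
                   (eqtype.dfwith (eqtype.dfwith x yz.1) yz.2) in
  let! v := objective F x in
  tret (x, v).

(* At least one trial is made; this matters only when epsilon >= 1. *)
Definition ntrials (R : realType) (c1 : R -> R) (m : modulus) (d : nat)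
    (n : 'I_d -> nat) (epsilon delta : R) : nat :=
  let t := ln (1 / epsilon) * ((c2 m)%:R / c1 delta) ^+ (d - 2) *
           \prod_(k < d | (k < d - 2)%N) (n k)%:R `^ (5 * delta) in
  absz (Num.max 1 (Num.ceil t))%R.

(* The random entries xi r and the seed s r are those of trial r. Evaluating
   the number of trials is charged with 3 (d - 2) + 5 steps: a power and two
   products for each of the d - 2 random modes, then 1 / epsilon, ln, c2 / c1,
   the ceiling and the maximum. *)
Definition algA (R : realType) (S : Type) (sub : bilinear_algorithm R S)
    (c1 : R -> R) (m : modulus) (d : nat) (hd : (2 <= d)%N) (n : 'I_d -> nat)
    (F : midx n -> R[i]) (epsilon delta : R)
    (xi : 'I_(ntrials c1 m n epsilon delta) -> lead_pos d n -> R[i])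
    (s : 'I_(ntrials c1 m n epsilon delta) -> S) :
    timed (option (vecs R n * R)) :=
  let! _ := charge (3 * (d - 2) + 5) tt in
  tloop (enum 'I_(ntrials c1 m n epsilon delta))
    (fun r best =>
       let! new := trial sub hd F (xi r) (s r) in
       if best is Some old then
         tstep (if old.2 < new.2 then Some new else Some old)
       else tstep (Some new))
    None.

(* The random choices made by a run: in each of the N trials, the entries of
   xi^1, ..., xi^(d-2) are uniform on Omega_m and the seed of the subroutine
   has law nu, all these being mutually independent. *)
Definition random_choices (R : realType) (dS : measure_display)
    (S : measurableType dS) (nu : probability S R) (m : modulus) (I : finType)
    (N : nat) (dT : measure_display) (T : measurableType dT)
    (P : probability T R) (xi : 'I_N -> I -> T -> R[i]) (s : 'I_N -> T -> S) :
    Prop :=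
  [/\ forall r u, uniform_on P m (xi r u),
      forall r, measurable_fun setT (s r) /\
        (forall A, measurable A -> P (s r @^-1` A) = nu A) &
      mutually_independent P
        (fun j : ('I_N * I) + 'I_N =>
           match j with
           | inl (r, u) => preimage_set_system setT (xi r u) (@cborel R)
           | inr r => preimage_set_system setT (s r) measurable
           end)].

(* Main.v *)
Require Import Defs.
From HB Require Import structures.
From mathcomp Require Import all_boot all_order all_algebra.
From mathcomp Require Import all_classical all_reals all_analysis.
From mathcomp Require Import measurable_realfun complex lra zify.

Set Implicit Arguments.
Unset Strict Implicit.
Unset Printing Implicit Defensive.

Import Order.TTheory GRing.Theory Num.Theory.

Local Open Scope classical_set_scope.
Local Open Scope complex_scope.
Local Open Scope ring_scope.

(** Compare one trial with a fixed feasible point [x]. Its first [d - 2] modes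
    are replaced, one after the other, by the random vectors of the trial.
    When the modes below [k] have been replaced, the form is linear in mode
    [k]; its value at [x k] is at most the l1-norm of the coefficients, since
    the entries of [x k] have modulus one. By the specification of [c1], the
    random vector of mode [k] achieves [gain k] times this norm with
    probability at least [success k], whatever the coefficients, and these
    depend on the earlier random modes only. Hence, with probability at least
    the product [p] of the [success k], the value reached is at least the
    product of the [gain k] times that of [x]: this is [trial_success]. The
    conditioning on the earlier modes is Fubini's theorem for two independent
    blocks of entries ([blocks_independent], [probability_fubini_ge]). No
    maximum over the remaining modes enters the argument, because [x] is
    chosen before the random entries; so all events are given by finitely many
    polynomial expressions in the entries and are measurable.

    On such a trial the last two modes of [x] compete in the bilinear problem
    handed to the subroutine, so the trial returns at least [c4] times the
    value reached ([trial_approx]). The trials are independent: all of them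
    fail with probability at most [(1 - p) ^+ N <= expR (- p * N)], which the
    choice of the number [N] of trials makes at most [epsilon]
    ([some_trial_succeeds], [expn_ntrials_le]).

    It remains to replace the value of [x] by the supremum [vmax]. Instead of
    a maximizer, a maximizing sequence is used: the limit superior of the good
    events of its terms still has probability at least [1 - epsilon], and on
    it the output, which does not depend on the term, is good enough for
    infinitely many of them ([good_run]).

    For the running time, [5 * delta < 1] bounds the number of trials by a
    constant times [ln (1 / epsilon)] times the number of entries of the
    tensor ([ntrials_le]), up to one more trial, and the cost of a trial is
    linear in that number of entries apart from the call to the subroutine
    ([algA_polytime]). *)

(** * Independence and conditioning *)

Section Independence.
Local Open Scope ereal_scope.
Context (R : realType) (dT : measure_display) (T : measurableType dT)
  (P : probability T R).

(** Both [B |-> P (A `&` B)] and [B |-> P A * P B] are finite measures, so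
    agreement on the pi-system [G] extends to the sigma-algebra that it
    generates. *)
Lemma sigma_independent_right (A : set T) (G : set (set T)) :
  measurable A -> G `<=` measurable -> setI_closed G -> G setT ->
  (forall B, G B -> P (A `&` B) = P A * P B) ->
  forall B, <<s G >> B -> P (A `&` B) = P A * P B.
Proof.
move=> mA mG GI GT AG B sB.
have PA0 : (0 <= fine (P A))%R by rewrite fine_ge0.
pose m1 : {measure set T -> \bar R} := mrestr P mA.
pose m2 : {measure set T -> \bar R} := mscale (NngNum PA0) P.
have PAE : (fine (P A))%:E = P A by rewrite fineK ?fin_num_measure.
have : m1 B = m2 B.
  apply: (g_sigma_algebra_measure_unique G mG (fun=> setT)) sB => //.
  - by rewrite bigcup_const //; exists 0%N.
  - move=> C GC; rewrite /m1 /m2 /= /mrestr /mscale/= setIC AG //.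
    by congr (_ * _); exact/esym.
  - move=> _; rewrite /m1 /mrestr/=.
    by rewrite ltey_eq fin_num_measure //; exact: measurableI.
rewrite /m1 /m2 /= /mrestr /mscale/= setIC => ->.
by congr (_ * _).
Qed.

Lemma sigma_independent (G1 G2 : set (set T)) :
  G1 `<=` measurable -> setI_closed G1 -> G1 setT ->
  G2 `<=` measurable -> setI_closed G2 -> G2 setT ->
  (forall A B, G1 A -> G2 B -> P (A `&` B) = P A * P B) ->
  forall A B, <<s G1 >> A -> <<s G2 >> B -> P (A `&` B) = P A * P B.
Proof.
move=> mG1 I1 T1 mG2 I2 T2 G12 A B sA sB.
have sm2 : <<s G2 >> `<=` measurable.
  by apply: smallest_sub => //; exact: sigma_algebra_measurable.
rewrite setIC muleC.
apply: (sigma_independent_right _ mG1 I1 T1 _ sA) => [|C G1C]; first exact: sm2.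
rewrite setIC muleC.
apply: (sigma_independent_right _ mG2 I2 T2 _ sB) => //; first exact: mG1.
by move=> D G2D; exact: G12.
Qed.

Variables (I : finType) (G : I -> set (set T)).
Hypothesis mG : forall i, G i `<=` measurable.
Hypothesis GI : forall i, setI_closed (G i).
Hypothesis GT : forall i, G i setT.
Hypothesis indepG : mutually_independent P G.

(** The pi-system of rectangles that constrain only the coordinates in [J];
    the sigma-algebra that it generates stands for the information carried by
    the block [J]. *)
Definition block_cylinders (J : {set I}) : set (set T) :=
  [set \bigcap_(i in [set` J]) A i | A in [set A | forall i, G i (A i)]].

Lemma block_cylinders_measurable J : block_cylinders J `<=` measurable.
Proof.
move=> _ [A GA <-]; apply: fin_bigcap_measurable => // i _.
by apply: mG; exact: GA.
Qed.

Lemma block_cylindersI J : setI_closed (block_cylinders J).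
Proof.
move=> _ _ [A GA <-] [B GB <-]; exists (fun i => A i `&` B i).
  by move=> i; exact: GI.
by rewrite bigcapI.
Qed.

Lemma block_cylindersT J : block_cylinders J setT.
Proof. by exists (fun=> setT) => //; rewrite bigcapT. Qed.

Lemma block_cylinders_gen (J : {set I}) i A :
  i \in J -> G i A -> block_cylinders J A.
Proof.
move=> iJ GA; exists (fun k => if k == i then A else setT).
  by move=> k /=; case: eqP => [->|].
apply/seteqP; split=> [w /(_ i)|w Aw k _] /=; first by rewrite eqxx; apply.
by case: eqP.
Qed.

Lemma block_sub_measurable J : <<s block_cylinders J >> `<=` measurable.
Proof.
apply: smallest_sub; first exact: sigma_algebra_measurable.
exact: block_cylinders_measurable.
Qed.

Lemma block_mono (J1 J2 : {set I}) : J1 \subset J2 ->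
  <<s block_cylinders J1 >> `<=` <<s block_cylinders J2 >>.
Proof.
move=> J12; apply: smallest_sub; first exact: smallest_sigma_algebra.
apply: subset_trans; last exact: sub_gen_smallest.
move=> _ [A GA <-]; exists (fun i => if i \in J1 then A i else setT).
  by move=> i /=; case: ifP.
apply/seteqP; split=> w /= Aw i iJ.
  by have := Aw i (fintype.subsetP J12 _ iJ); rewrite iJ.
by case: ifP => // iJ1; exact: Aw.
Qed.

(** On rectangles this is mutual independence applied to the union of the two
    blocks; the rest is the extension from pi-systems to sigma-algebras. *)
Lemma blocks_independent (J1 J2 : {set I}) : [disjoint J1 & J2]%B ->
  forall A B, <<s block_cylinders J1 >> A -> <<s block_cylinders J2 >> B ->
    P (A `&` B) = P A * P B.
Proof.
move=> J12; apply: sigma_independent;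
  try exact: block_cylinders_measurable;
  try exact: block_cylindersI; try exact: block_cylindersT.
move=> _ _ [A GA <-] [B GB <-].
have N2 i : i \in J2 -> i \in J1 = false by exact: disjointFl J12.
pose C i := if i \in J1 then A i else B i.
have GC i : G i (C i) by rewrite /C; case: ifP => _; [exact: GA|exact: GB].
have AC : \bigcap_(i in [set` J1]) A i = \bigcap_(i in [set` J1]) C i.
  by apply: eq_bigcapr => i /= iJ1; rewrite /C iJ1.
have BC : \bigcap_(i in [set` J2]) B i = \bigcap_(i in [set` J2]) C i.
  by apply: eq_bigcapr => i /= iJ2; rewrite /C N2.
rewrite AC BC -bigcap_setU.
rewrite (_ : [set` J1] `|` [set` J2] = [set` (J1 :|: J2)%SET]); last first.
  by apply/seteqP; split=> i /=; rewrite inE => /orP.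
rewrite !indepG => [|i _|i _|i _]; try exact: GC.
rewrite (big_setID J1); congr (_ * _); apply: eq_bigl => i; rewrite !inE.
  by rewrite andbC; case: (i \in J1).
by case: (boolP (i \in J2)) => [/N2->|]; case: (i \in J1).
Qed.

End Independence.

(** The conditioning argument, free of conditional probabilities. Independence
    makes the joint law of [X] and [Y] the product of their laws; hence a
    lower bound [q] for the law of [Y] on every section of [C] above [D]
    integrates over [D]. *)
Lemma probability_fubini_ge (R : realType) (d0 d1 d2 : measure_display)
    (T : measurableType d0) (T1 : measurableType d1) (T2 : measurableType d2)
    (P : probability T R) (X : {mfun T >-> T1}) (Y : {mfun T >-> T2})
    (D : set T1) (C : set (T1 * T2)) (q : R) :
  (forall A B, measurable A -> measurable B ->
    P (X @^-1` A `&` Y @^-1` B) = P (X @^-1` A) * P (Y @^-1` B))%E ->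
  measurable D -> measurable C -> 0 <= q ->
  (forall x, D x -> (q%:E <= P (Y @^-1` xsection C x))%E) ->
  (q%:E * P (X @^-1` D) <= P [set w | D (X w) /\ C (X w, Y w)])%E.
Proof.
move=> indXY mD mC q0 DC.
have mXY : measurable_fun setT (fun w => (X w, Y w)).
  exact: measurable_fun_pair.
pose XY : {mfun T >-> (T1 * T2)%type} :=
  HB.pack (fun w => (X w, Y w)) (isMeasurableFun.Build _ _ _ _ _ mXY).
pose C' := C `&` (D `*` setT).
have mC' : measurable C' by apply: measurableI => //; exact: measurableX.
have CE : (distribution P X \x distribution P Y)%E C' = distribution P XY C'.
  by apply: product_measure_unique mC' => A B mA mB; exact: indXY.
have -> : P [set w | D (X w) /\ C (X w, Y w)] = distribution P XY C'.
  rewrite /distribution /pushforward; congr (P _).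
  by apply/seteqP; split=> w /=; [case=> ? ?|case=> ? []].
rewrite -CE /product_measure1/=.
have -> : (q%:E * P (X @^-1` D) =
    \int[distribution P X]_x (q%:E * (\1_D x)%:E))%E.
  rewrite ge0_integralZl ?integral_indic ?setIT//.
  by apply/measurable_EFinP; exact: measurable_indic.
apply: ge0_le_integral => //.
- by move=> x _; rewrite mule_ge0 ?lee_fin.
- by apply: measurable_funeM; apply/measurable_EFinP; exact: measurable_indic.
- exact: measurable_fun_xsection.
move=> x _; rewrite indicE; have [xD|xD] := boolP (x \in D); last first.
  by rewrite mule0.
rewrite mule1; apply: le_trans (DC x (set_mem xD)) _.
rewrite le_eqVlt; apply/orP; left; apply/eqP; congr (P _).
apply/seteqP; split=> w /=; rewrite /xsection/= !inE.
  by move=> Cxw; split => //; split => //; exact: set_mem.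
by case.
Qed.

(** Every event prescribed on a coordinate of the subfamily is transported to
    its image coordinate; injectivity makes this unambiguous. *)
Lemma mutually_independent_inj (R : realType) (dT : measure_display)
    (T : measurableType dT) (P : probability T R) (I I' : finType)
    (h : I' -> I) (G : I -> set (set T)) :
  injective h -> mutually_independent P G ->
  mutually_independent P (fun i => G (h i)).
Proof.
move=> hI iG J A GA.
pose A' j := if [pick i in J | h i == j] is Some i then A i else setT.
have A'E i : i \in J -> A' (h i) = A i.
  move=> iJ; rewrite /A'; case: pickP => [k /andP[_ /eqP/hI->]//|/(_ i)].
  by rewrite /= iJ eqxx.
have -> : \bigcap_(i in [set` J]) A i =
          \bigcap_(j in [set` [set h i | i in J]%SET]) A' j.
  apply/seteqP; split=> w Aw.
    by move=> _ /= /imsetP[i iJ ->]; rewrite A'E //; exact: Aw.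
  by move=> i /= iJ; rewrite -(A'E i iJ); apply: Aw => /=; exact: imset_f.
rewrite iG; last by move=> _ /imsetP[i iJ ->]; rewrite A'E //; exact: GA.
rewrite big_imset /=; last by move=> ? ? _ _; exact: hI.
by apply: eq_bigr => i iJ; rewrite A'E.
Qed.

(** * Measurability of complex-valued functions *)

Section ComplexMeasurable.
Context (R : realType) (dT : measure_display) (T : measurableType dT).
Implicit Types f g : T -> R[i].

(** Measurability for [cborel], spelt out on real and imaginary parts so that
    the real-valued closure properties apply. *)
Definition cmeasurable f : Prop :=
  measurable_fun setT (fun w => complex.Re (f w)) /\
  measurable_fun setT (fun w => complex.Im (f w)).

Lemma cmeasurable_cst (c : R[i]) : cmeasurable (fun=> c).
Proof. by split; exact: measurable_cst. Qed.

Lemma cmeasurableD f g :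
  cmeasurable f -> cmeasurable g -> cmeasurable (fun w => f w + g w).
Proof.
move=> [rf jf] [rg jg]; split.
  have := measurable_funD rf rg; congr (measurable_fun _ _).
  by apply/funext => w /=; case: (f w) (g w) => [a b] [c e].
have := measurable_funD jf jg; congr (measurable_fun _ _).
by apply/funext => w /=; case: (f w) (g w) => [a b] [c e].
Qed.

Lemma cmeasurableM f g :
  cmeasurable f -> cmeasurable g -> cmeasurable (fun w => f w * g w).
Proof.
move=> [rf jf] [rg jg]; split.
  have := measurable_funB (measurable_funM rf rg) (measurable_funM jf jg).
  congr (measurable_fun _ _).
  by apply/funext => w /=; case: (f w) (g w) => [a b] [c e].
have := measurable_funD (measurable_funM rf jg) (measurable_funM jf rg).
congr (measurable_fun _ _).
by apply/funext => w /=; case: (f w) (g w) => [a b] [c e].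
Qed.

Lemma cmeasurable_sum (I : Type) (r : seq I) (Q : pred I)
    (f : I -> T -> R[i]) :
  (forall i, Q i -> cmeasurable (f i)) ->
  cmeasurable (fun w => \sum_(i <- r | Q i) f i w).
Proof.
move=> mf; elim: r => [|i r IH].
  rewrite (_ : (fun w => _) = (fun=> 0)); first exact: cmeasurable_cst.
  by apply/funext => w; rewrite big_nil.
rewrite (_ : (fun w => _) = (fun w => if Q i
    then f i w + \sum_(j <- r | Q j) f j w
    else \sum_(j <- r | Q j) f j w)); last first.
  by apply/funext => w; rewrite big_cons.
by case: (boolP (Q i)) => // Qi; apply: cmeasurableD => //; exact: mf.
Qed.

Lemma cmeasurable_prod (I : Type) (r : seq I) (Q : pred I)
    (f : I -> T -> R[i]) :
  (forall i, Q i -> cmeasurable (f i)) ->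
  cmeasurable (fun w => \prod_(i <- r | Q i) f i w).
Proof.
move=> mf; elim: r => [|i r IH].
  rewrite (_ : (fun w => _) = (fun=> 1)); first exact: cmeasurable_cst.
  by apply/funext => w; rewrite big_nil.
rewrite (_ : (fun w => _) = (fun w => if Q i
    then f i w * \prod_(j <- r | Q j) f j w
    else \prod_(j <- r | Q j) f j w)); last first.
  by apply/funext => w; rewrite big_cons.
by case: (boolP (Q i)) => // Qi; apply: cmeasurableM => //; exact: mf.
Qed.

Lemma cmeasurable_preimage f :
  preimage_set_system setT f (@cborel R) `<=` measurable -> cmeasurable f.
Proof.
move=> mf; split=> _ B mB; apply: mf.
  exists (@complex.Re R @^-1` B) => //.
  by rewrite /cborel/= -[X in measurable X]setTI; exact: measurable_fst.
exists (@complex.Im R @^-1` B) => //.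
by rewrite /cborel/= -[X in measurable X]setTI; exact: measurable_snd.
Qed.

End ComplexMeasurable.

Lemma cmeasurable_comp (R : realType) (d1 d2 : measure_display)
    (T1 : measurableType d1) (T2 : measurableType d2) (f : T2 -> R[i])
    (g : T1 -> T2) :
  cmeasurable f -> measurable_fun setT g -> cmeasurable (fun w => f (g w)).
Proof.
move=> [rf jf] mg; split; first exact (measurableT_comp rf mg).
exact (measurableT_comp jf mg).
Qed.

Lemma cborelI (R : realType) : setI_closed (@cborel R).
Proof. by move=> A B mA mB; exact: measurableI. Qed.

Lemma preimage_set_systemI (aT rT : Type) (D : set aT) (f : aT -> rT)
    (G : set (set rT)) :
  setI_closed G -> setI_closed (preimage_set_system D f G).
Proof.
move=> GI _ _ [A GA <-] [B GB <-]; exists (A `&` B); first exact: GI.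
by rewrite preimage_setI setIACA setIid.
Qed.

Lemma preimage_set_systemT (aT rT : Type) (f : aT -> rT) (G : set (set rT)) :
  G setT -> preimage_set_system setT f G setT.
Proof. by move=> GT; exists setT => //; rewrite preimage_setT setTI. Qed.

(** * Replacing the modes of a fixed point one at a time *)

Section Multilinear.
Context (R : realType) (d : nat) (n : 'I_d -> nat) (F : midx n -> R[i]).
Implicit Types x y z : vecs R n.

(** The coefficient vector, at mode [k], of the linear form obtained from [F]
    by freezing all the other modes at [x]. *)
Definition slice x (k : 'I_d) (j : 'I_(n k)) : R[i] :=
  \sum_(i : midx n | i k == j) F i * \prod_(l < d | l != k) x l (i l) 0.

Lemma mlform_slice x k : mlform F x = \sum_j slice x j * x k j 0.
Proof.
rewrite /mlform (partition_big (fun i : midx n => i k) predT) //=.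
apply: eq_bigr => j _; rewrite /slice mulr_suml; apply: eq_bigr => i /eqP ij.
by rewrite (bigD1 k) //= ij -mulrA [X in _ * X]mulrC.
Qed.

Lemma eq_slice x y k : (forall l, l != k -> x l = y l) ->
  @slice x k = @slice y k.
Proof.
move=> xy; apply/funext => j; apply: eq_bigr => i _; congr (_ * _).
by apply: eq_bigr => l lk; rewrite xy.
Qed.

(** The points that interpolate between a fixed [x] and the random [z]: modes
    are replaced one at a time, in increasing order, so that only mode [K]
    changes from [hybrid K] to [hybrid K.+1]. *)
Definition hybrid (K : nat) z x : vecs R n :=
  fun k => if (k < K)%N then z k else x k.

(** The coefficients of the linear form at mode [k] do not see that mode, so
    replacing it leaves them unchanged. *)
Lemma slice_hybridS (k : 'I_d) z x :
  @slice (hybrid k.+1 z x) k = @slice (hybrid k z x) k.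
Proof.
apply: eq_slice => l lk.
by rewrite /hybrid ltnS leq_eqVlt (inj_eq val_inj) (negbTE lk).
Qed.

Lemma mlform_hybrid (k : 'I_d) z x :
  mlform F (hybrid k z x) = \sum_j slice (hybrid k z x) j * x k j 0.
Proof. by rewrite (mlform_slice _ k) /hybrid ltnn. Qed.

Lemma mlform_hybridS (k : 'I_d) z x :
  mlform F (hybrid k.+1 z x) = \sum_j slice (hybrid k z x) j * z k j 0.
Proof. by rewrite (mlform_slice _ k) slice_hybridS {2}/hybrid ltnSn. Qed.

End Multilinear.

Lemma Re_le_norm (R : realType) (z : R[i]) : complex.Re z <= complex.Re `|z|.
Proof.
apply: le_trans (ler_norm _) _.
by rewrite -lecR (le_trans (normc_ge_Re z)) // normc_def.
Qed.

Lemma Omega_norm (R : realType) (m : modulus) (z : R[i]) :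
  Omega m z -> `|z| = 1.
Proof.
case: m => [k|//] [j _ <-]; rewrite normrX (_ : `|omega R k| = 1) ?expr1n//.
by rewrite normc_def /omega /expi /= cos2Dsin2 sqrtr1.
Qed.

(** The step that turns the l1-norm in the specification of [c1] into an
    objective value: the frozen point can do no better than the l1-norm of its
    coefficients. *)
Lemma Re_sum_le_l1 (R : realType) (m : modulus) (p : nat) (a : 'I_p -> R[i])
    (x : 'cV[R[i]]_p) : Omega_vec m x ->
  complex.Re (\sum_i a i * x i 0) <= \sum_i complex.Re `|a i|.
Proof.
move=> Ox; rewrite raddf_sum; apply: ler_sum => i _.
by apply: le_trans (Re_le_norm _) _; rewrite normrM (Omega_norm (Ox i)) mulr1.
Qed.

Lemma c2_gt0 (m : modulus) : admissible m -> (0 < c2 m)%N.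
Proof.
case: m => [k|//] /= k3; case: arg_minnP => [|i /andP[i2 _] _].
  by rewrite dvdnn (leq_trans _ k3).
exact: leq_trans i2.
Qed.

Section SingleTrial.
Context (R : realType) (m : modulus) (hm : admissible m).
Context (d : nat) (n : 'I_d -> nat) (hn : forall k, (0 < n k)%N).
Context (F : midx n -> R[i]) (c1 : R -> R) (hc1 : c1_spec c1).
Context (delta : R) (hdelta : 0 < delta < 16^-1).
Context (x : vecs R n) (hx : feasible m x).

Definition gain (k : 'I_d) : R := Num.sqrt (delta * ln (n k)%:R / (n k)%:R).

(** The probability with which, by the specification of [c1], a random vector
    of mode [k] achieves [gain k] times the l1-norm of the coefficients. *)
Definition success (k : 'I_d) : R :=
  c1 delta / ((c2 m)%:R * (n k)%:R `^ (5 * delta)).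

Definition mode (u : lead_pos d n) : 'I_d := tag (val u).

Definition mode_prefix (K : nat) : {set lead_pos d n} :=
  [set u | (mode u < K)%N].

Definition mode_level (K : nat) : {set lead_pos d n} :=
  [set u | mode u == K :> nat].

Section Measurability.
Context (dT : measure_display) (T : measurableType dT)
  (xi : lead_pos d n -> T -> R[i]) (J : {set lead_pos d n}).
Hypothesis mxi : forall u, u \in J -> cmeasurable (xi u).

Let z w := lead_vecs (fun u => xi u w).

Lemma cmeasurable_lead (k : 'I_d) (j : 'I_(n k)) :
  (forall u : lead_pos d n, mode u = k -> u \in J) ->
  cmeasurable (fun w => z w k j 0).
Proof.
move=> kJ; rewrite /z /lead_vecs.
have -> : (fun w => lead_vecs (fun u => xi u w) k j 0) =
          (fun w => if insub (Tagged (fun k => 'I_(n k)) j) is Some u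
                    then xi u w else 0) by apply/funext => w; rewrite mxE.
case: insubP => [u _ uE|_]; last exact: cmeasurable_cst.
by apply/mxi/kJ; rewrite /mode uE.
Qed.

Lemma cmeasurable_hybrid (K : nat) (k : 'I_d) (j : 'I_(n k)) :
  mode_prefix K \subset J -> cmeasurable (fun w => hybrid K (z w) x k j 0).
Proof.
move=> KJ; rewrite /hybrid; case: (boolP (k < K)%N) => kK; last first.
  exact: cmeasurable_cst.
apply: cmeasurable_lead => u uk; apply: (fintype.subsetP KJ).
by rewrite inE uk.
Qed.

Lemma cmeasurable_mlform_hybrid (K : nat) :
  mode_prefix K \subset J -> cmeasurable (fun w => mlform F (hybrid K (z w) x)).
Proof.
move=> KJ; apply: cmeasurable_sum => i _.
apply: cmeasurableM; first exact: cmeasurable_cst.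
by apply: cmeasurable_prod => k _; exact: cmeasurable_hybrid.
Qed.

Lemma cmeasurable_slice_hybrid (K : nat) (k : 'I_d) (j : 'I_(n k)) :
  mode_prefix K \subset J -> cmeasurable (fun w => slice F (hybrid K (z w) x) j).
Proof.
move=> KJ; apply: cmeasurable_sum => i _.
apply: cmeasurableM; first exact: cmeasurable_cst.
by apply: cmeasurable_prod => l _; exact: cmeasurable_hybrid.
Qed.

Lemma measurable_Re_ge (c : R) (f : T -> R[i]) :
  cmeasurable f -> measurable [set w | c <= complex.Re (f w)].
Proof.
move=> [rf _]; rewrite -[X in measurable X]setTI.
rewrite (_ : [set w | _] = (fun w => complex.Re (f w)) @^-1` `[c, +oo[).
  by apply: rf => //; exact: measurable_itv.
by apply/seteqP; split=> w /=; rewrite in_itv/= andbT.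
Qed.

End Measurability.

(** The value guaranteed once the first [K] modes of [x] have been replaced. *)
Definition target (K : nat) : R :=
  (\prod_(k < d | (k < K)%N) gain k) * complex.Re (mlform F x).

Lemma gain_ge0 k : 0 <= gain k.
Proof. exact: sqrtr_ge0. Qed.

Lemma success_gt0 k : 0 < success k.
Proof.
have [c0 _] := hc1 hdelta.
by rewrite divr_gt0 // mulr_gt0 ?powR_gt0 ?ltr0n ?c2_gt0.
Qed.

Context (dT : measure_display) (T : measurableType dT) (P : probability T R)
  (xi : lead_pos d n -> T -> R[i]) (hxi : iid_uniform P m xi).

Let G u := preimage_set_system setT (xi u) (@cborel R).
Let z w := lead_vecs (fun u => xi u w).

Lemma entry_events_measurable u : G u `<=` measurable.
Proof. by move=> _ [A mA <-]; rewrite setTI; have [] := hxi.1 u A mA. Qed.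

Lemma lead_vecsE (k : 'I_d) (kd : (k < d - 2)%N) (y : lead_pos d n -> R[i]) j :
  lead_vecs y k j 0 = y (exist _ (Tagged (fun k => 'I_(n k)) j) kd).
Proof. by rewrite mxE insubT. Qed.

(** The entries of a single mode are an i.i.d. subfamily, so the specification
    of [c1] applies to them. *)
Lemma mode_success (k : 'I_d) (a : 'I_(n k) -> R[i]) : (k < d - 2)%N ->
  ((success k)%:E <= P [set w | gain k * (\sum_j complex.Re `|a j|) <=
                               complex.Re (\sum_j a j * z w k j 0)]%R)%E.
Proof.
move=> kd.
pose pos j : lead_pos d n := exist _ (Tagged (fun k => 'I_(n k)) j) kd.
have pos_inj : injective pos.
  by move=> j j' /(congr1 val)/eqP; rewrite /= eq_Tagged => /eqP.
have iidk : iid_uniform P m (fun j => xi (pos j)).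
  split=> [j|]; first exact: hxi.1.
  exact: (mutually_independent_inj pos_inj hxi.2).
have := (hc1 hdelta).2 _ m (\col_j a j) (hn k) hm _ _ _ _ iidk.
rewrite (eq_bigr (fun j => complex.Re `|a j|)) => [|j _]; last by rewrite mxE.
congr (_ <= P _)%E; apply/funext => w; congr (_ <= complex.Re _).
by apply: eq_bigr => j _; rewrite mxE lead_vecsE.
Qed.

Let GI u : setI_closed (G u).
Proof. by apply: preimage_set_systemI; exact: cborelI. Qed.

Let GT u : G u setT.
Proof.
by apply: preimage_set_systemT; rewrite /cborel/= (_ : [set _ | _] = setT).
Qed.

(** The event is decided by the entries of the first [K] modes, through
    finitely many sums and products; comparing with the fixed [x] instead of
    maximising over the remaining modes is what makes this immediate. *)
Lemma trial_event_sigma (K : nat) (H : set (set T)) :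
  (forall u, (mode u < K)%N -> G u `<=` <<s H >>) ->
  <<s H >> [set w | target K <= complex.Re (mlform F (hybrid K (z w) x))].
Proof.
move=> GH; set T1 := g_sigma_algebraType H.
apply: (@measurable_Re_ge _ T1).
apply: (cmeasurable_mlform_hybrid (J := mode_prefix K)) => // u.
by rewrite inE => uK; apply: cmeasurable_preimage; exact: GH.
Qed.

Let entry_sigma (J : {set lead_pos d n}) u : u \in J ->
  G u `<=` <<s block_cylinders G J >>.
Proof.
move=> uJ A GA; apply: sub_gen_smallest.
exact: block_cylinders_gen GT _ _ _ uJ GA.
Qed.

Let entry_cmeasurable (J : {set lead_pos d n}) u : u \in J ->
  @cmeasurable R _ (g_sigma_algebraType (block_cylinders G J)) (xi u).
Proof. by move=> uJ; apply: cmeasurable_preimage; exact: entry_sigma. Qed.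

(** Induction on the number of replaced modes. Given the entries of the modes
    below [K], the form is linear in mode [K] with coefficients independent of
    that mode; their l1-norm is at least the current value, because the
    entries of [x] have modulus one, and [mode_success] applies on each
    section. [probability_fubini_ge] multiplies the probabilities. *)
Lemma trial_success (K : nat) : (K <= d - 2)%N ->
  ((\prod_(k < d | (k < K)%N) success k)%:E <=
    P [set w | target K <= complex.Re (mlform F (hybrid K (z w) x))]%R)%E.
Proof.
have mG := entry_events_measurable.
have mH k : measurable [set w | target k <=
    complex.Re (mlform F (hybrid k (z w) x))].
  apply: (block_sub_measurable mG (J := [set: lead_pos d n]%SET)).
  apply: trial_event_sigma => u _; apply: entry_sigma.
  by rewrite finset.in_setT.
elim: K => [_|K IH KD].
  rewrite big_pred0 // (_ : [set w | _] = setT) ?probability_setT //.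
  apply/seteqP; split=> // w _ /=.
  by rewrite /target big_pred0 // mul1r.
have Kd : (K < d)%N by rewrite (leq_trans KD) ?leq_subr.
pose k := Ordinal Kd.
set H := (X in (_ <= P X)%E).
have prodS (f : 'I_d -> R) : \prod_(l < d | (l < K.+1)%N) f l =
    f k * \prod_(l < d | (l < K)%N) f l.
  rewrite (bigD1 k) //=; congr (_ * _); apply: eq_bigl => l.
  by rewrite ltnS ltn_neqAle andbC -(inj_eq val_inj).
pose J1 : {set lead_pos d n} := mode_prefix K.
pose J2 : {set lead_pos d n} := mode_level K.
have J12 : [disjoint J1 & J2]%B.
  rewrite disjoint_subset; apply/fintype.subsetP => u; rewrite !inE.
  by move=> uK; rewrite neq_ltn uK.
pose T1 := g_sigma_algebraType (block_cylinders G J1).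
pose T2 := g_sigma_algebraType (block_cylinders G J2).
have mX : measurable_fun setT (fun w : T => w : T1).
  by move=> _ B; rewrite setTI; exact: block_sub_measurable.
have mY : measurable_fun setT (fun w : T => w : T2).
  by move=> _ B; rewrite setTI; exact: block_sub_measurable.
pose X : {mfun T >-> T1} :=
  HB.pack (fun w : T => w : T1) (isMeasurableFun.Build _ _ _ _ _ mX).
pose Y : {mfun T >-> T2} :=
  HB.pack (fun w : T => w : T2) (isMeasurableFun.Build _ _ _ _ _ mY).
pose D : set T1 :=
  [set w | target K <= complex.Re (mlform F (hybrid K (z w) x))].
pose C : set (T1 * T2) := [set p | target K.+1 <=
  complex.Re (\sum_j slice F (hybrid K (z p.1) x) j * z p.2 k j 0)].
have mD : measurable D.
  by apply: trial_event_sigma => u uK; apply: entry_sigma; rewrite inE.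
have mC : measurable C.
  apply: measurable_Re_ge; apply: cmeasurable_sum => j _; apply: cmeasurableM.
    apply: (cmeasurable_comp (T2 := T1)
      (f := fun w => slice F (hybrid K (z w) x) j) _ measurable_fst).
    by apply: cmeasurable_slice_hybrid => //; exact: entry_cmeasurable.
  apply: (cmeasurable_comp (T2 := T2)
    (f := fun w => z w k j 0) _ measurable_snd).
  apply: (cmeasurable_lead (J := J2)); first exact: entry_cmeasurable.
  by move=> u uk; rewrite inE uk.
have targetS : target K.+1 = gain k * target K by rewrite /target prodS mulrA.
have indXY A B : measurable A -> measurable B ->
    P (X @^-1` A `&` Y @^-1` B) = (P (X @^-1` A) * P (Y @^-1` B))%E.
  by move=> *; exact: (blocks_independent mG GI GT hxi.2 J12).
(* On a section, the coefficients are constants and only mode K is random. *)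
have section w : D w -> ((success k)%:E <= P (Y @^-1` xsection C w))%E.
  move=> Dw; set a := fun j : 'I_(n k) => slice F (hybrid K (z w) x) j.
  apply: le_trans (mode_success a KD) _; apply: le_measure; rewrite ?inE.
  - apply: measurable_Re_ge; apply: cmeasurable_sum => j _.
    apply: cmeasurableM; first exact: cmeasurable_cst.
    apply: (cmeasurable_lead (J := [set: lead_pos d n]%SET)) => u _.
      by apply: cmeasurable_preimage; exact: mG.
    by rewrite finset.in_setT.
  - by have := mY measurableT _ (measurable_xsection w mC); rewrite setTI.
  - move=> w' /= aw'; rewrite /xsection/= inE /C/= targetS.
    apply: le_trans aw'; rewrite ler_wpM2l ?gain_ge0 //.
    apply: (le_trans (Dw : target K <= _)).
    rewrite (mlform_hybrid F k).
    exact: (Re_sum_le_l1 a (@hx k)).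
have := probability_fubini_ge indXY mD mC (ltW (success_gt0 k)) section.
rewrite prodS => step; apply: le_trans (le_trans step _).
  rewrite [leLHS]EFinM; apply: lee_pmul => //; last by apply: IH; exact: ltnW.
    by rewrite lee_fin ltW ?success_gt0.
  by rewrite lee_fin prodr_ge0 // => l _; rewrite ltW ?success_gt0.
(* Forget that the previous modes were good as well. *)
apply: le_measure; rewrite ?inE.
- rewrite (_ : [set w | _] = [set w | target K <=
      complex.Re (mlform F (hybrid K (z w) x))] `&` H).
    by apply: measurableI; exact: mH.
  by apply/seteqP; split=> w /=; rewrite /C/= -mlform_hybridS.
- exact: mH.
- by move=> w /= [_]; rewrite /C/= -mlform_hybridS.
Qed.

End SingleTrial.

(** * Independent repetition *)

Section IndependentTrials.
Local Open Scope ereal_scope.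
Context (R : realType) (dT : measure_display) (T : measurableType dT)
  (P : probability T R) (I : finType) (G : I -> set (set T)).
Hypothesis mG : forall i, G i `<=` measurable.
Hypothesis GI : forall i, setI_closed (G i).
Hypothesis GT : forall i, G i setT.
Hypothesis indepG : mutually_independent P G.
Context (K : finType) (J : K -> {set I}) (E : K -> set T) (p : R).
Hypothesis JE : forall r, <<s block_cylinders G (J r) >> (E r).
Hypothesis J0 : forall r r', r != r' -> [disjoint J r & J r']%B.
Hypothesis pE : forall r, p%:E <= P (E r).

Lemma trial_measurable r : measurable (E r).
Proof. by apply: (block_sub_measurable mG); exact: JE. Qed.

(** Induction on the list of trials: the failures of the trials in the tail
    are decided by the union of their blocks, which is disjoint from the block
    of the head. *)
Lemma all_trials_fail (s : seq K) : uniq s ->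
  P (\big[setI/setT]_(r <- s) ~` E r) <= ((1 - p) ^+ size s)%:E.
Proof.
pose V (s : seq K) : {set I} := [set i | has (fun r => i \in J r) s]%SET.
have sV s' : <<s block_cylinders G (V s') >> (\big[setI/setT]_(r <- s') ~` E r).
  set T1 := g_sigma_algebraType (block_cylinders G (V s')).
  rewrite big_seq; apply: (@bigsetI_measurable _ T1) => r rs.
  apply: (@measurableC _ T1); apply: (block_mono GT (J1 := J r)); last exact: JE.
  by apply/fintype.subsetP => i iJ; rewrite inE; apply/hasP; exists r.
elim: s => [_|r s IH /= /andP[rs us]]; first by rewrite big_nil probability_setT.
have sEC : <<s block_cylinders G (J r) >> (~` E r).
  apply: (@measurableC _ (g_sigma_algebraType (block_cylinders G (J r)))).
  exact: JE.
have JV : [disjoint J r & V s]%B.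
  rewrite disjoint_subset; apply/fintype.subsetP => i iJ; rewrite !inE.
  apply/hasPn => r' r's; apply: contraTN iJ => iJ'.
  rewrite (disjointFl (J0 _) iJ') //.
  by apply: contraNneq rs => ->.
rewrite big_cons (blocks_independent mG GI GT indepG JV) //.
rewrite exprS EFinM; apply: lee_pmul => //; last exact: IH.
rewrite probability_setC; last exact: trial_measurable.
by rewrite EFinB leeB.
Qed.

Lemma some_trial_succeeds :
  (1 - (1 - p) ^+ #|K|)%:E <= P (\bigcup_r E r).
Proof.
have mU : measurable (\bigcup_r E r).
  by apply: fin_bigcup_measurable => // r _; exact: trial_measurable.
rewrite -[X in P X]setCK probability_setC; last exact: measurableC.
rewrite EFinB leeB // setC_bigcup cardE.
apply: le_trans (all_trials_fail (enum_uniq _)).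
apply: le_measure; rewrite ?inE.
- by rewrite -setC_bigcup; exact: measurableC.
- apply: bigsetI_measurable => r _; apply: measurableC.
  exact: trial_measurable.
- by move=> w Ew; rewrite -bigcap_seq => r _; exact: Ew.
Qed.

End IndependentTrials.

Lemma prod_lead_cst (R : realType) (d : nat) (c : R) :
  \prod_(k < d | (k < d - 2)%N) c = c ^+ (d - 2).
Proof.
by rewrite -(big_ord_widen d (fun=> c)) ?leq_subr // prodr_const card_ord.
Qed.

(** The number of trials is at least [ln (1 / epsilon) / p], and
    [(1 - p) ^+ N <= expR (- p * N)]. *)
Lemma expn_ntrials_le (R : realType) (m : modulus) (hm : admissible m)
    (d : nat) (n : 'I_d -> nat) (hn : forall k, (0 < n k)%N)
    (c1 : R -> R) (hc1 : c1_spec c1) (delta epsilon : R) :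
  0 < delta < 16^-1 -> 0 < epsilon ->
  let p := \prod_(k < d | (k < d - 2)%N) success m n c1 delta k in
  p <= 1 -> (1 - p) ^+ ntrials c1 m n epsilon delta <= epsilon.
Proof.
move=> hdelta e0 p p1.
have [c0 _] := hc1 _ hdelta.
have p0 : 0 < p by apply: prodr_gt0 => k _; exact: success_gt0.
have c20 : 0 < (c2 m)%:R :> R by rewrite ltr0n c2_gt0.
have pE : p^-1 = ((c2 m)%:R / c1 delta) ^+ (d - 2) *
    \prod_(k < d | (k < d - 2)%N) (n k)%:R `^ (5 * delta).
  rewrite -prod_lead_cst -big_split -prodfV; apply: eq_bigr => k _ /=.
  by rewrite /success invf_div mulrAC.
have Nge : ln (1 / epsilon) / p <= (ntrials c1 m n epsilon delta)%:R.
  rewrite /ntrials pE mulrA; set t := _ * _ * _.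
  apply: le_trans (Num.Theory.ceil_ge t) _.
  rewrite -[X in _ <= X]/((absz _)%:~R) gez0_abs ?le_max // ler_int.
  by rewrite le_max lexx orbT.
have le1 := expR_ge1Dx (- p).
apply: (@le_trans _ _ (expR (- p) ^+ ntrials c1 m n epsilon delta)).
  by apply: lerXn2r; rewrite ?nnegrE ?subr_ge0 ?expR_ge0.
rewrite -expRM_natl -[leRHS]lnK ?posrE // ler_expR.
rewrite ler_pdivrMr // div1r lnV ?posrE // in Nge.
by rewrite mulrN lerNl.
Qed.

(** * The event on which a run is good *)

Lemma Omega1 (R : realType) (m : modulus) : admissible m -> Omega m (1 : R[i]).
Proof.
case: m => [k|] /=; last by rewrite normr1.
by move=> k3; exists 0%N; rewrite ?expr0 //=; exact: leq_trans k3.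
Qed.

Lemma cborel_point (R : realType) (c : R[i]) : cborel [set c].
Proof.
case: c => a b; rewrite /cborel/=.
rewrite (_ : [set _ | _] = [set a] `*` [set b]).
  by apply: measurableX; exact: measurable_set1.
by apply/seteqP; split=> -[p q] /= [-> ->].
Qed.

Lemma cborel_Omega (R : realType) (m : modulus) : cborel (@Omega R m).
Proof.
case: m => [k|]; rewrite /cborel/=.
  rewrite (_ : [set _ | _] = \bigcup_(j in [set j | (j < k)%N])
     [set p : R * R | p.1 +i* p.2 = omega R k ^+ j]).
    by apply: bigcup_measurable => j _; exact: cborel_point.
  by apply/seteqP; split=> p /= [j jk Ej]; exists j.
have m2 : measurable_fun setT (fun p : R * R => p.1 ^+ 2 + p.2 ^+ 2).
  apply: measurable_funD; apply: measurable_funX;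
  [exact: measurable_fst|exact: measurable_snd].
rewrite (_ : [set _ | _] =
  (fun p : R * R => p.1 ^+ 2 + p.2 ^+ 2) @^-1` [set 1]).
  by rewrite -[X in measurable X]setTI; apply: m2 => //; exact: measurable_set1.
apply/seteqP; split=> -[a b] /=; rewrite normc_def /=.
  move=> [/(congr1 (fun t => t ^+ 2))]; rewrite sqr_sqrtr ?expr1n //.
  by rewrite addr_ge0 ?sqr_ge0.
by move=> ->; rewrite sqrtr1.
Qed.

Lemma uniform_Omega_Omega (R : realType) (m : modulus) :
  admissible m -> uniform_Omega m (@Omega R m) = 1%E.
Proof.
case: m => [k|] /= hk.
  rewrite (eq_bigr (fun=> 1)) => [|j _].
    rewrite sumr_const card_ord divff // pnatr_eq0.
    by case: k hk.
  by rewrite indicE mem_set //; exists j => //=.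
rewrite (_ : _ @^-1` _ = setT); first exact: probability_setT.
apply/seteqP; split=> // t _ /=.
by rewrite normc_def /expi /= cos2Dsin2 sqrtr1.
Qed.

(** The crude bound that makes the feasible values bounded above. *)
Lemma mlform_le (R : realType) (m : modulus) (d : nat) (n : 'I_d -> nat)
    (F : midx n -> R[i]) (x : vecs R n) : feasible m x ->
  complex.Re (mlform F x) <= \sum_i complex.Re `|F i|.
Proof.
move=> hx; rewrite raddf_sum; apply: ler_sum => i _.
apply: le_trans (Re_le_norm _) _; rewrite normrM normr_prod big1 ?mulr1 //.
by move=> k _; exact: Omega_norm (hx k (i k)).
Qed.

Lemma has_sup_objective (R : realType) (m : modulus) (d : nat)
    (n : 'I_d -> nat) (F : midx n -> R[i]) : admissible m ->
  has_sup [set complex.Re (mlform F x) | x in @feasible R m d n].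
Proof.
move=> hm; split; last first.
  exists (\sum_i complex.Re `|F i|) => _ [x hx <-]; exact: mlform_le hx.
exists (complex.Re (mlform F (fun k => const_mx 1))).
exists (fun k => const_mx 1) => //.
by move=> k i; rewrite mxE; exact: Omega1.
Qed.

(** Each tail union contains one of the events, and [lim_sup_set E] is the
    decreasing limit of the tail unions. *)
Lemma lim_sup_prob_ge (R : realType) (dT : measure_display)
    (T : measurableType dT) (P : probability T R) (E : (set T)^nat) (p : \bar R) :
  (forall j, measurable (E j)) -> (forall j, p <= P (E j))%E ->
  (p <= P (lim_sup_set E))%E.
Proof.
move=> mE pE.
have cvgE : P (\bigcup_(j >= k) E j) @[k --> \oo] --> P (lim_sup_set E).
  apply: lim_sup_set_cvg => //.
  by rewrite ltey_eq fin_num_measure //; exact: bigcup_measurable.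
rewrite -(cvg_lim _ cvgE) //; apply: lime_ge.
  by apply/cvg_ex; eexists; exact: cvgE.
apply: nearW => k; apply: le_trans (pE k) _; apply: le_measure; rewrite ?inE //.
  exact: bigcup_measurable.
by apply: bigcup_sup => /=.
Qed.

Lemma probability_full_bigcap (R : realType) (dT : measure_display)
    (T : measurableType dT) (P : probability T R) (I : finType)
    (A : set T) (B : I -> set T) :
  measurable A -> (forall i, measurable (B i)) -> (forall i, P (B i) = 1%E) ->
  P (A `&` \bigcap_i B i) = P A.
Proof.
move=> mA mB PB.
have mBs : measurable (\bigcap_i B i) by apply: fin_bigcap_measurable.
have CB0 : P (~` \bigcap_i B i) = 0%E.
  rewrite setC_bigcap; apply/negligibleP.
    by apply: fin_bigcup_measurable => // i _; exact: measurableC.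
  rewrite -bigsetU_fset_set; last exact: finite_finset.
  apply: (@big_ind _ P.-negligible) => [|C D|i _].
  - exact: negligible_set0.
  - exact: negligibleU.
  - apply/negligibleP; first exact: measurableC.
    by apply: etrans (probability_setC P (mB i)) _; rewrite PB subee.
transitivity (P (A `\` \bigcap_i B i) + P (A `&` \bigcap_i B i))%E; last first.
  exact/esym/measureDI.
rewrite (_ : P (A `\` _) = 0%E) ?add0e //.
apply/eqP; rewrite eq_le measure_ge0 andbT -CB0; apply: le_measure.
- by rewrite inE; exact: measurableD.
- by rewrite inE; exact: measurableC.
- by move=> w [].
Qed.

Lemma ntrials_gt0 (R : realType) (c1 : R -> R) (m : modulus) (d : nat)
    (n : 'I_d -> nat) (epsilon delta : R) :
  (0 < ntrials c1 m n epsilon delta)%N.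
Proof. by rewrite absz_gt0; apply/lt0r_neq0; rewrite lt_max ltr01. Qed.

Section RandomRun.
Context (R : realType) (m : modulus) (hm : admissible m) (d : nat)
  (n : 'I_d -> nat) (hn : forall k, (0 < n k)%N) (F : midx n -> R[i])
  (c1 : R -> R) (hc1 : c1_spec c1) (delta epsilon : R)
  (hdelta : 0 < delta < 16^-1) (heps : 0 < epsilon).
Context (dS : measure_display) (S : measurableType dS) (nu : probability S R)
  (dT : measure_display) (T : measurableType dT) (P : probability T R).
Let N := ntrials c1 m n epsilon delta.
Context (xi : 'I_N -> lead_pos d n -> T -> R[i]) (s : 'I_N -> T -> S)
  (hrandom : random_choices nu m P xi s).

Definition trial_event (x : vecs R n) (r : 'I_N) : set T :=
  [set w | target F delta x (d - 2) <=
    complex.Re (mlform F (hybrid (d - 2) (lead_vecs (fun u => xi r u w)) x))].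

Let G (j : ('I_N * lead_pos d n) + 'I_N) : set (set T) :=
  match j with
  | inl (r, u) => preimage_set_system setT (xi r u) (@cborel R)
  | inr r => preimage_set_system setT (s r) measurable
  end.

Let mG j : G j `<=` measurable.
Proof.
have [hxi hs _] := hrandom.
case: j => [[r u]|r] _ [A mA <-].
  by rewrite setTI; have [] := hxi r u A mA.
by have [/(_ measurableT _ mA)] := hs r.
Qed.

Let GI j : setI_closed (G j).
Proof.
case: j => [[r u]|r]; apply: preimage_set_systemI; first exact: cborelI.
by move=> A B mA mB; exact: measurableI.
Qed.

Let GT j : G j setT.
Proof.
case: j => [[r u]|r]; apply: preimage_set_systemT => //.
by rewrite /cborel/= (_ : [set _ | _] = setT).
Qed.

Let indepG : mutually_independent P G.
Proof. by have [_ _] := hrandom. Qed.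

Let J (r : 'I_N) : {set ('I_N * lead_pos d n) + 'I_N} :=
  [set j | if j is inl (r', _) then r' == r else false]%SET.

Lemma trial_iid r : iid_uniform P m (xi r).
Proof.
have [hxi _ _] := hrandom; split=> [u|]; first exact: hxi.
have inlI : injective (fun u : lead_pos d n => inl 'I_N (r, u)).
  by move=> u u' [].
exact: (mutually_independent_inj inlI indepG).
Qed.

Lemma trial_event_block x r : <<s block_cylinders G (J r) >> (trial_event x r).
Proof.
apply: trial_event_sigma => u _ A GA; apply: sub_gen_smallest.
by apply: (block_cylinders_gen GT (i := inl (r, u))) => //; rewrite inE.
Qed.

Lemma trial_event_measurable x r : measurable (trial_event x r).
Proof. by apply: (block_sub_measurable mG); exact: trial_event_block. Qed.

Lemma some_trial_good x : feasible m x ->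
  ((1 - epsilon)%:E <= P (\bigcup_r trial_event x r))%E.
Proof.
move=> hx; pose p := \prod_(k < d | (k < d - 2)%N) success m n c1 delta k.
have pE r : (p%:E <= P (trial_event x r))%E.
  exact: (trial_success hm hn F hc1 hdelta hx (trial_iid r)).
have JD r r' : r != r' -> [disjoint J r & J r']%B.
  move=> rr'; rewrite disjoint_subset; apply/fintype.subsetP => j; rewrite !inE.
  by case: j => [[r'' u]|//] /eqP->.
have := some_trial_succeeds mG GI GT indepG (trial_event_block x) JD pE.
apply: le_trans; rewrite lee_fin lerD2l lerN2 card_ord.
apply: (expn_ntrials_le hm hn hc1 hdelta heps).
rewrite -lee_fin; apply: le_trans (pE (Ordinal (ntrials_gt0 _ _ _ _ _))) _.
by apply: probability_le1; exact: trial_event_measurable.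
Qed.

(** The optimum is only known as a supremum, so [x] runs through a maximizing
    sequence; each term is good for some trial with probability at least
    [1 - epsilon], hence so are infinitely many terms at once. On the unit
    circle the entries are feasible only almost surely, which is why the event
    is also intersected with [Omega]. *)
Lemma good_run :
  exists Ev : set T, [/\ measurable Ev, ((1 - epsilon)%:E <= P Ev)%E &
    forall w, Ev w -> (forall r u, Omega m (xi r u w)) /\
      forall e, 0 < e -> exists x : vecs R n, [/\ feasible m x,
        vmax m F - e < complex.Re (mlform F x) & exists r, trial_event x r w]].
Proof.
have hs := has_sup_objective F hm.
have /choice[x hx] (j : nat) : exists x : vecs R n, feasible m x /\
    vmax m F - j.+1%:R^-1 < complex.Re (mlform F x).
  have j0 : (0 : R) < j.+1%:R^-1 by rewrite invr_gt0.
  by have [_ [x fx <-] xj] := sup_adherent j0 hs; exists x.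
pose E j := \bigcup_r trial_event (x j) r.
have mE j : measurable (E j).
  by apply: fin_bigcup_measurable => // r _; exact: trial_event_measurable.
pose B (ru : 'I_N * lead_pos d n) : set T := xi ru.1 ru.2 @^-1` @Omega R m.
have uB ru := (trial_iid ru.1).1 ru.2 _ (@cborel_Omega R m).
exists (lim_sup_set E `&` \bigcap_ru B ru).
have mlim : measurable (lim_sup_set E).
  apply: bigcap_measurableType => k _.
  by apply: bigcup_measurable => j _; exact: mE.
have mB ru : measurable (B ru) by have [] := uB ru.
split.
- apply: measurableI => //; apply: fin_bigcap_measurable => [|ru _].
    exact: finite_finset.
  exact: mB.
- rewrite probability_full_bigcap // => [|ru]; last first.
    by have [_ ->] := uB ru; exact: uniform_Omega_Omega.
  apply: lim_sup_prob_ge => // j; apply: some_trial_good; exact: (hx j).1.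
move=> w [Ew Bw]; split=> [r u|e e0]; first exact: (Bw (r, u)).
(* From this index on, the deficit (j + 1)^-1 is smaller than e. *)
have [j /= ej [r _ Er]] : (\bigcup_(j >= Num.bound e^-1) E j) w by exact: Ew.
exists (x j); split; [exact: (hx j).1| |by exists r].
apply: le_lt_trans (hx j).2; rewrite lerD2l lerN2 invf_ple ?posrE // ltW //.
apply: lt_le_trans (archi_boundP _) _; first by rewrite invr_ge0 ltW.
by rewrite ler_nat leqW.
Qed.

End RandomRun.

(** * What the algorithm computes *)

Lemma tloop_value (I A : Type) (s : seq I) (body : I -> A -> timed A) (a : A) :
  (tloop s body a).1 = foldl (fun a i => (body i a).1) a s.
Proof. by elim: s a => //= i s IH a; rewrite IH. Qed.

Lemma tloop_sum (V : nmodType) (I : Type) (s : seq I)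
    (body : I -> V -> timed V) (f : I -> V) (a : V) :
  (forall i b, (body i b).1 = b + f i) ->
  (tloop s body a).1 = a + \sum_(i <- s) f i.
Proof.
move=> bE; elim: s a => [|i s IH] a; first by rewrite big_nil addr0.
by rewrite /= IH bE big_cons addrA.
Qed.

Lemma c4_ge0 (R : realType) (m : modulus) : 0 <= c4 R m.
Proof.
have c0 : 0 <= 7118 / 10 ^+ 4 :> R.
  by apply: divr_ge0; [exact: ler0n|apply: exprn_ge0; exact: ler0n].
rewrite /c4; case: m => [k|]; last exact: c0.
by apply: mulr_ge0; [exact: c0|exact: sqr_ge0].
Qed.

Section Semantics.
Context (R : realType) (d : nat) (hd : (2 <= d)%N) (n : 'I_d -> nat)
  (F : midx n -> R[i]).
Implicit Types x : vecs R n.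

Lemma monomial_value x i ks c :
  (monomial x i ks c).1 = c * \prod_(k <- ks) x k (i k) 0.
Proof.
rewrite /monomial tloop_value /=.
elim: ks c => [|k ks IH] c /=; first by rewrite big_nil mulr1.
by rewrite IH big_cons mulrA.
Qed.

Lemma objective_value x : (objective F x).1 = complex.Re (mlform F x).
Proof.
rewrite /objective /=.
rewrite (@tloop_sum _ _ _ _ (fun i => F i * \prod_k x k (i k) 0)) => [|i v].
  by rewrite add0r big_enum.
by rewrite /= monomial_value big_enum.
Qed.

Lemma contract_value x : (Defs.contract hd F x).1 =
  \sum_(i : midx n) (F i * \prod_(k < d | (k < d - 2)%N) x k (i k) 0) *:
    delta_mx (i (penult hd)) (i (ultim hd)).
Proof.
rewrite /Defs.contract /=; rewrite (@tloop_sum _ _ _ _ (fun i =>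
  (F i * \prod_(k < d | (k < d - 2)%N) x k (i k) 0) *:
    delta_mx (i (penult hd)) (i (ultim hd)))) => [|i B].
  by rewrite add0r big_enum.
by rewrite /= monomial_value /lead_modes big_filter big_enum_cond.
Qed.

Lemma penult_neq_ultim : penult hd != ultim hd.
Proof. by rewrite -(inj_eq val_inj) /=; lia. Qed.

Lemma prod_modes (f : 'I_d -> R[i]) :
  \prod_k f k = (\prod_(k < d | (k < d - 2)%N) f k) *
                f (penult hd) * f (ultim hd).
Proof.
rewrite (bigD1 (ultim hd)) //= (bigD1 (penult hd)) ?penult_neq_ultim //=.
rewrite mulrC -mulrA [X in _ = X]mulrA; congr (_ * _); rewrite mulrC.
congr (_ * _); apply: eq_bigl => k.
rewrite -!(inj_eq val_inj) /=; have := ltn_ord k; lia.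
Qed.

Definition complete x
    (yz : 'cV[R[i]]_(n (penult hd)) * 'cV[R[i]]_(n (ultim hd))) : vecs R n :=
  eqtype.dfwith (eqtype.dfwith x yz.1) yz.2.

Lemma complete_penult x yz : complete x yz (penult hd) = yz.1.
Proof.
by rewrite /complete dfwith_out 1?eq_sym ?penult_neq_ultim // dfwith_in.
Qed.

Lemma complete_ultim x yz : complete x yz (ultim hd) = yz.2.
Proof. by rewrite /complete dfwith_in. Qed.

Lemma complete_lead x yz (k : 'I_d) : (k < d - 2)%N -> complete x yz k = x k.
Proof.
move=> kd; rewrite /complete !dfwith_out // -(inj_eq val_inj) /=; lia.
Qed.

Lemma biformE (p q : nat) (B : 'M[R[i]]_(p, q)) (y : 'cV_p) (z : 'cV_q) :
  biform B y z = (y^T *m B *m z) 0 0.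
Proof.
rewrite mxE /biform exchange_big; apply: eq_bigr => j _; rewrite mxE mulr_suml.
by apply: eq_bigr => i _; rewrite mxE [y i 0 * _]mulrC.
Qed.

(** Completing the random modes by a feasible point of the bilinear problem
    gives the same objective value; this transfers both the value of the point
    found and its comparison with the optimum. *)
Lemma biform_contract x yz :
  biform (Defs.contract hd F x).1 yz.1 yz.2 = mlform F (complete x yz).
Proof.
rewrite contract_value biformE mulmx_sumr mulmx_suml summxE.
apply: eq_bigr => i _; rewrite prod_modes complete_penult complete_ultim.
rewrite -scalemxAr -scalemxAl mxE -!mulrA; congr (_ * _).
congr (_ * _); first by apply: eq_bigr => k kd; rewrite complete_lead.
rewrite -(mul_delta_mx (0 : 'I_1)) mulmxA -colE -mulmxA -rowE.
by rewrite mxE big_ord1 !mxE.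
Qed.

Context (S : Type) (sub : bilinear_algorithm R S).

Lemma trial_value (xi : lead_pos d n -> R[i]) (s : S) :
  let y := complete (lead_vecs xi)
    (sub (Defs.contract hd F (lead_vecs xi)).1 s).1 in
  (trial sub hd F xi s).1 = (y, complex.Re (mlform F y)).
Proof. by rewrite /= -objective_value. Qed.

Context (m : modulus) (hn : forall k, (0 < n k)%N)
  (hsub : bilinear_approx m sub).

Lemma trial_feasible (xi : lead_pos d n -> R[i]) (s : S) :
  (forall u, Omega m (xi u)) -> feasible m (trial sub hd F xi s).1.1.
Proof.
move=> Oxi; rewrite trial_value /= => k i.
have [Oy Oz _] := hsub (Defs.contract hd F (lead_vecs xi)).1 s (hn _) (hn _).
case: (ltnP k (d - 2)) => [kd|dk].
  by rewrite complete_lead // lead_vecsE.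
have [kp|kp] := eqVneq k (penult hd).
  by move: i; rewrite kp => i; rewrite complete_penult.
have ku : k = ultim hd.
  apply: val_inj; move: kp; rewrite -(inj_eq val_inj) /=.
  by have := ltn_ord k; lia.
by move: i; rewrite ku => i; rewrite complete_ultim.
Qed.

(** The last two modes of [x] are feasible for the bilinear problem of the
    trial, whose optimum is therefore at least the value at the hybrid point. *)
Lemma trial_approx (xi : lead_pos d n -> R[i]) (s : S) (x : vecs R n) :
  feasible m x ->
  c4 R m * complex.Re (mlform F (hybrid (d - 2) (lead_vecs xi) x))
    <= (trial sub hd F xi s).1.2.
Proof.
move=> hx; set z := lead_vecs xi; rewrite trial_value /= -biform_contract -/z.
set B := (Defs.contract hd F z).1.
have [_ _ ] := hsub B s (hn _) (hn _); apply: le_trans.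
rewrite ler_wpM2l ?c4_ge0 //; apply: ub_le_sup.
  exists (\sum_i \sum_j complex.Re `|B i j|) => _ [[y w] /= [Oy Ow] <-].
  rewrite raddf_sum; apply: ler_sum => i _; rewrite raddf_sum.
  apply: ler_sum => j _; apply: le_trans (Re_le_norm _) _.
  by rewrite !normrM (Omega_norm (Oy i)) (Omega_norm (Ow j)) !mulr1.
exists (x (penult hd), x (ultim hd)) => /=; first by split=> i; exact: hx.
rewrite (biform_contract z (x (penult hd), x (ultim hd))).
congr (complex.Re (mlform F _)); apply: functional_extensionality_dep => k.
rewrite /hybrid; case: ltnP => [kd|dk]; first by rewrite complete_lead.
have [->|kp] := eqVneq k (penult hd); first by rewrite complete_penult.
have -> : k = ultim hd.
  apply: val_inj; move: kp; rewrite -(inj_eq val_inj) /=.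
  by have := ltn_ord k; lia.
by rewrite complete_ultim.
Qed.

End Semantics.

Definition keep_best (R : realType) (A : Type) (b : A * R)
    (best : option (A * R)) : timed (option (A * R)) :=
  if best is Some old then tstep (if old.2 < b.2 then Some b else Some old)
  else tstep (Some b).

(** The body of the main loop compares with a value already found, hence the
    induction starts from an arbitrary [old]. *)
Lemma best_of_trials_from (R : realType) (A : Type) (I : eqType) (s : seq I)
    (new : I -> timed (A * R)) (old : A * R) :
  exists b, [/\ (tloop s (fun i best => let! c := new i in keep_best c best)
                  (Some old)).1 = Some b,
    b = old \/ (exists i, b = (new i).1), old.2 <= b.2 &
    forall i, i \in s -> (new i).1.2 <= b.2].
Proof.
elim: s old => [|i s IH] old /=; first by exists old; split=> //; left.
have [lt|ge] := ltP old.2 (new i).1.2.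
  have [b [-> bE leb bs]] := IH (new i).1; exists b; split=> //.
  - by right; case: bE => // ->; exists i.
  - exact: le_trans (ltW lt) leb.
  - by move=> j; rewrite inE => /orP[/eqP->|/bs].
have [b [-> bE leb bs]] := IH old; exists b; split=> //.
by move=> j; rewrite inE => /orP[/eqP->|/bs//]; exact: le_trans leb.
Qed.

Lemma best_of_trials (R : realType) (A : Type) (I : eqType) (s : seq I)
    (new : I -> timed (A * R)) : s != [::] ->
  exists b, [/\ (tloop s (fun i best => let! c := new i in keep_best c best)
                  None).1 = Some b,
    exists i, b = (new i).1 &
    forall i, i \in s -> (new i).1.2 <= b.2].
Proof.
case: s => [//|i s _] /=.
have [b [-> bE leb bs]] := best_of_trials_from s new (new i).1.
exists b; split=> // [|j]; first by case: bE => // ->; exists i.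
by rewrite inE => /orP[/eqP->|/bs].
Qed.

(** The shape of the approximation ratio: the factors [Num.sqrt delta] are
    collected into a power of [delta]. *)
Lemma prod_gainE (R : realType) (d : nat) (n : 'I_d -> nat) (delta : R) :
  0 < delta -> (forall k, (0 < n k)%N) ->
  \prod_(k < d | (k < d - 2)%N) gain n delta k =
  delta `^ ((d - 2)%:R / 2) *
    Num.sqrt (\prod_(k < d | (k < d - 2)%N) (ln (n k)%:R / (n k)%:R)).
Proof.
move=> d0 hn.
have lnn k : 0 <= ln (n k)%:R / (n k)%:R :> R.
  by rewrite divr_ge0 // ln_ge0 // ler1n.
have sqrt_prod (I : Type) (s : seq I) (Q : pred I) (f : I -> R) :
    (forall i, 0 <= f i) ->
    Num.sqrt (\prod_(i <- s | Q i) f i) = \prod_(i <- s | Q i) Num.sqrt (f i).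
  move=> f0; elim: s => [|i s IH]; first by rewrite !big_nil sqrtr1.
  by rewrite !big_cons; case: ifP => // _; rewrite sqrtrM // IH.
rewrite sqrt_prod // [(d - 2)%:R / 2]mulrC powRrM.
rewrite powR12_sqrt ?ltW // powR_mulrn ?sqrtr_ge0 // -prod_lead_cst -big_split.
apply: eq_bigr => k _; by rewrite /gain -mulrA sqrtrM ?ltW.
Qed.

(** * The number of steps *)

(** Each iteration is charged one step on top of its body. *)
Lemma tloop_cost (I A : Type) (s : seq I) (body : I -> A -> timed A) (c : nat)
    (a : A) :
  (forall i b, ((body i b).2 <= c)%N) -> ((tloop s body a).2 <= size s * c.+1)%N.
Proof.
move=> bc; elim: s a => //= i s IH a.
by have := bc i a; have := IH (body i a).1; rewrite mulSn /=; lia.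
Qed.

Section Cost.
Context (R : realType) (d : nat) (hd : (2 <= d)%N) (n : 'I_d -> nat)
  (hn : forall k, (0 < n k)%N) (F : midx n -> R[i]).
Implicit Types x : vecs R n.

Let M := (\prod_(k < d) n k)%N.

Lemma card_midx : #|{: midx n}| = M.
Proof.
rewrite card_dep_ffun foldrE big_map big_enum.
by apply: eq_bigr => k _; rewrite card_ord.
Qed.

Lemma dim_le_volume k : (n k <= M)%N.
Proof. by rewrite /M (bigD1 k) //= leq_pmulr // prodn_gt0. Qed.

Lemma penult_ultim_le_volume : (n (penult hd) * n (ultim hd) <= M)%N.
Proof.
rewrite /M (bigD1 (penult hd)) //= (bigD1 (ultim hd)) /=; last first.
  by rewrite eq_sym penult_neq_ultim.
by rewrite mulnA leq_pmulr // prodn_cond_gt0.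
Qed.

Lemma card_lead_pos : (#|{: lead_pos d n}| <= d * M)%N.
Proof.
rewrite card_sig; apply: leq_trans (max_card _) _.
rewrite card_tagged sumnE big_map big_enum /=.
apply: (@leq_trans (\sum_(k < d) M)%N).
  by apply: leq_sum => k _; rewrite card_ord dim_le_volume.
by rewrite sum_nat_const card_ord.
Qed.

Lemma monomial_cost x i ks c : ((monomial x i ks c).2 <= size ks * 2)%N.
Proof. exact: tloop_cost. Qed.

Lemma contract_cost x : ((Defs.contract hd F x).2 <= (2 * d + 4) * M)%N.
Proof.
rewrite /Defs.contract /=; set l := tloop _ _ _.
have cl : (l.2 <= M * (2 * d + 2).+1)%N.
  rewrite -card_midx cardE; apply: tloop_cost => i B /=.
  have := monomial_cost x i (lead_modes d) (F i).
  have : (size (lead_modes d) <= d)%N.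
    by rewrite size_filter (leq_trans (count_size _ _)) // size_enum_ord.
  by rewrite /=; lia.
have := penult_ultim_le_volume; move: cl; lia.
Qed.

Lemma objective_cost x : ((objective F x).2 <= (2 * d + 3) * M)%N.
Proof.
rewrite /objective /=; set l := tloop _ _ _.
have cl : (l.2 <= M * (2 * d + 1).+1)%N.
  rewrite -card_midx cardE; apply: tloop_cost => i B /=.
  by have := monomial_cost x i (enum 'I_d) (F i); rewrite size_enum_ord /=; lia.
(* The last step, extracting the real part, is absorbed by one unit of M. *)
have : (0 < M)%N by rewrite prodn_gt0.
move: cl; lia.
Qed.

Context (S : Type) (sub : bilinear_algorithm R S).

Lemma trial_cost (b : nat) (xi : lead_pos d n -> R[i]) (s : S) :
  (forall B, ((@sub (n (penult hd)) (n (ultim hd)) B s).2 <= b)%N) ->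
  ((trial sub hd F xi s).2 <= (5 * d + 9) * M + b)%N.
Proof.
move=> subb; set B := Defs.contract hd F (lead_vecs xi).
set y := complete (lead_vecs xi) (sub B.1 s).1.
have -> : (trial sub hd F xi s).2 = (#|{: lead_pos d n}| + (B.2 +
    ((sub B.1 s).2 + ((n (penult hd) + n (ultim hd)) +
      ((objective F y).2 + 0)))))%N by [].
have := contract_cost (lead_vecs xi); rewrite -/B.
have := objective_cost y.
have := card_lead_pos; have := dim_le_volume (penult hd).
have := dim_le_volume (ultim hd); have := subb B.1.
lia.
Qed.
End Cost.

(** As [5 * delta < 1] and [1 <= n k], each [n k `^ (5 * delta)] is at most
    [n k], so the number of trials is at most linear in the size of the
    tensor. The leading [1] covers both the rounding up and the minimum of one
    trial. *)
Lemma ntrials_le (R : realType) (m : modulus) (hm : admissible m)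
    (d : nat) (n : 'I_d -> nat) (hn : forall k, (0 < n k)%N)
    (c1 : R -> R) (hc1 : c1_spec c1) (delta epsilon : R) :
  0 < delta < 16^-1 -> 0 < epsilon ->
  (ntrials c1 m n epsilon delta)%:R <= 1 + Num.max 0 (ln (1 / epsilon)) *
    ((c2 m)%:R / c1 delta) ^+ (d - 2) * (\prod_(k < d) n k)%N%:R.
Proof.
move=> hdelta e0; have [c0 _] := hc1 _ hdelta.
set L := Num.max 0 _; set C := _ ^+ (d - 2).
have C0 : 0 <= C by rewrite exprn_ge0 // divr_ge0 // ltW.
have L0 : 0 <= L by rewrite le_max lexx.
have powle : \prod_(k < d | (k < d - 2)%N) (n k)%:R `^ (5 * delta) <=
    (\prod_(k < d) n k)%N%:R.
  rewrite natr_prod [leRHS](bigID (fun k : 'I_d => (k < d - 2)%N)) /=.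
  have ge1 (Q : pred 'I_d) : 1 <= \prod_(k | Q k) (n k)%:R :> R.
    by rewrite -natr_prod ler1n prodn_cond_gt0.
  rewrite -[leLHS]mulr1; apply: ler_pM => //.
    by apply: prodr_ge0 => k _; exact: powR_ge0.
  apply: ler_prod => k _; rewrite powR_ge0 /= -[leRHS]powRr1 //.
  apply: ler_powR; first by rewrite ler1n.
  by case/andP: hdelta; lra.
rewrite /ntrials; set t := _ * _ * _.
have tle : t <= L * C * (\prod_(k < d) n k)%N%:R.
  have prod0 : 0 <= \prod_(k < d | (k < d - 2)%N) (n k)%:R `^ (5 * delta).
    by apply: prodr_ge0 => k _; exact: powR_ge0.
  apply: le_trans (ler_wpM2l _ powle); last by rewrite mulr_ge0.
  by rewrite ler_wpM2r // ler_wpM2r // le_max lexx orbT.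
rewrite -[leLHS]/((absz _)%:~R) gez0_abs ?le_max // maxEle.
case: ifP => _; last by rewrite lerDl !mulr_ge0.
have := ceilB1_lt t; rewrite intrB ltrBlDr => /ltW cl.
by apply: le_trans cl _; rewrite addrC lerD2l.
Qed.

(** Taking absolute values of the coefficients makes a polynomial bound
    monotone, so that it may be evaluated at a larger argument. *)
Lemma polynomial_bound_monotone (R : realType) (f : {poly R}) :
  exists g : {poly R}, forall x y : R, 0 <= x <= y -> `|f.[x]| <= g.[y].
Proof.
exists (\poly_(i < size f) `|f`_i|) => x y /andP[x0 xy].
rewrite horner_poly horner_coef; apply: le_trans (ler_norm_sum _ _ _) _.
apply: ler_sum => i _; rewrite normrM [`|x ^+ i|]ger0_norm ?exprn_ge0 //.
rewrite ler_wpM2l //; apply: lerXn2r => //; rewrite nnegrE.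
exact: le_trans xy.
Qed.

(** Each trial takes a number of steps linear in the size of the tensor, plus
    one call to the subroutine on a matrix with no more entries than the
    tensor. *)
Lemma algA_polytime (R : realType) (m : modulus) (hm : admissible m)
  (d : nat) (hd : (2 <= d)%N) (c1 : R -> R) (hc1 : c1_spec c1)
  (S : Type) (sub : bilinear_algorithm R S) (hsubT : bilinear_polytime sub)
  (delta : R) (hdelta : 0 < delta < 16^-1) :
  exists f : {poly R},
     forall (n : 'I_d -> nat) (hn : forall k, (0 < n k)%N)
       (F : midx n -> R[i]) (epsilon : R) (heps : 0 < epsilon)
       (xi : 'I_(ntrials c1 m n epsilon delta) -> lead_pos d n -> R[i])
       (s : 'I_(ntrials c1 m n epsilon delta) -> S),
       (algA sub hd F xi s).2%:R <=
         f.[(\prod_(k < d) n k)%N%:R + Num.max 0 (ln (1 / epsilon))].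
Proof.
have [f fP] := hsubT; have [g gP] := polynomial_bound_monotone f.
pose C := ((c2 m)%:R / c1 delta) ^+ (d - 2).
exists ((3 * (d - 2) + 5)%N%:R%:P +
  (1%:P + C *: 'X^2) * ((5 * d + 9)%N%:R *: 'X + g + 2%:R%:P)).
move=> n hn F epsilon e0 xi s.
set M := (\prod_(k < d) n k)%N; set L := Num.max 0 _; set X := M%:R + L.
have L0 : 0 <= L by rewrite le_max lexx.
have X0 : 0 <= X by rewrite addr_ge0.
have C0 : 0 <= C by rewrite exprn_ge0 // divr_ge0 // ltW // (hc1 _ hdelta).1.
have MX : M%:R <= X by rewrite lerDl.
have LX : L <= X by rewrite lerDr.
have subg B t : ((sub (n (penult hd)) (n (ultim hd)) B t).2)%:R <= g.[X].
  apply: le_trans (fP _ _ B t (hn _) (hn _)) (le_trans (ler_norm _) (gP _ _ _)).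
  rewrite ler0n /=; apply: le_trans MX.
  by rewrite ler_nat penult_ultim_le_volume.
have g0 : 0 <= g.[X] by apply: le_trans (gP 0 X _); rewrite ?normr_ge0 ?lexx.
pose b := Num.truncn g.[X].
pose K := ((5 * d + 9) * M + b)%N.
have trialK r : ((trial sub hd F (xi r) (s r)).2 <= K)%N.
  by apply: trial_cost => // B; rewrite truncn_ge_nat.
have KX : K%:R <= (5 * d + 9)%N%:R * X + g.[X].
  by rewrite /K natrD natrM; apply: lerD; rewrite ?ler_wpM2l // truncn_le.
have Ncost : ((algA sub hd F xi s).2 <=
    3 * (d - 2) + 5 + ntrials c1 m n epsilon delta * (K + 1).+1)%N.
  rewrite /algA /= leq_add2l -[X in (_ <= X * _)%N]size_enum_ord.
  apply: tloop_cost => r best /=; apply: leq_add; first exact: trialK.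
  by case: best.
have NX : (ntrials c1 m n epsilon delta)%:R <= 1 + C * X ^+ 2.
  apply: le_trans (ntrials_le hm hn hc1 hdelta e0) _; rewrite -/L -/C -/M lerD2l.
  by rewrite [L * C]mulrC -mulrA ler_wpM2l // expr2 ler_pM.
have : (algA sub hd F xi s).2%:R <=
    (3 * (d - 2) + 5 + ntrials c1 m n epsilon delta * (K + 1).+1)%N%:R :> R.
  by rewrite ler_nat.
move=> /le_trans; apply; have -> : ((K + 1).+1 = K + 2)%N by rewrite addn1 addn2.
rewrite !(hornerD, hornerM, hornerC, hornerZ, hornerXn, hornerX).
rewrite natrD natrM lerD2l; apply: ler_pM => //.
by rewrite natrD lerD.
Qed.

(** * Approximation ratio and running time *)

Theorem theorem5p2 (R : realType) (m : modulus) (hm : admissible m)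
  (d : nat) (hd : (2 <= d)%N)
  (c1 : R -> R) (hc1 : c1_spec c1)
  (dS : measure_display) (S : measurableType dS) (nu : probability S R)
  (sub : bilinear_algorithm R S)
  (hsub : bilinear_approx m sub) (hsubT : bilinear_polytime sub)
  (delta : R) (hdelta : 0 < delta < 16^-1) :
  (exists f : {poly R},
     forall (n : 'I_d -> nat) (hn : forall k, (0 < n k)%N)
       (hmono : forall k l : 'I_d, (k <= l)%N -> (n k <= n l)%N)
       (F : midx n -> R[i]) (epsilon : R) (heps : 0 < epsilon)
       (xi : 'I_(ntrials c1 m n epsilon delta) -> lead_pos d n -> R[i])
       (s : 'I_(ntrials c1 m n epsilon delta) -> S),
       (algA sub hd F xi s).2%:R <=
         f.[(\prod_(k < d) n k)%N%:R + Num.max 0 (ln (1 / epsilon))]) /\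
  (forall (n : 'I_d -> nat) (hn : forall k, (0 < n k)%N)
     (hmono : forall k l : 'I_d, (k <= l)%N -> (n k <= n l)%N)
     (F : midx n -> R[i]) (epsilon : R) (heps : 0 < epsilon)
     (dT : measure_display) (T : measurableType dT) (P : probability T R)
     (xi : 'I_(ntrials c1 m n epsilon delta) -> lead_pos d n -> T -> R[i])
     (s : 'I_(ntrials c1 m n epsilon delta) -> T -> S)
     (hrandom : random_choices nu m P xi s),
     prob_ge P
       [set w | exists (y : vecs R n) (v : R),
          [/\ (algA sub hd F (fun r u => xi r u w) (fun r => s r w)).1
                = Some (y, v),
              feasible m y &
              complex.Re (mlform F y) >=
                c4 R m * delta `^ ((d - 2)%:R / 2) *
                Num.sqrt (\prod_(k < d | (k < d - 2)%N)
                            (ln (n k)%:R / (n k)%:R)) *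
                vmax m F]]
       (1 - epsilon)).
Proof.
split.
  have [f fP] := algA_polytime hm hd hc1 hsubT hdelta.
  by exists f => n hn _ F epsilon he xi s; exact: fP.
move=> n hn _ F epsilon he dT T P xi s hrandom.
have [Ev [mEv PEv EvP]] := good_run hm hn F hc1 hdelta he hrandom.
exists Ev; split=> // w /EvP[Oxi near_sup] /=.
have N0 : enum 'I_(ntrials c1 m n epsilon delta) != [::].
  by rewrite -size_eq0 size_enum_ord -lt0n ntrials_gt0.
have [[y v] [resE [r yvE] best]] := best_of_trials
  (fun r => trial sub hd F (fun u => xi r u w) (s r w)) N0.
have feas r' : feasible m (trial sub hd F (fun u => xi r' u w) (s r' w)).1.1.
  by apply: trial_feasible => // u; exact: Oxi.
have vE : v = complex.Re (mlform F y).
  by move: yvE; rewrite trial_value => -[-> ->].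
exists y, v; split; first exact: resE.
  by have := feas r; rewrite -yvE.
have d0 : 0 < delta by case/andP: hdelta.
rewrite -vE -[c4 R m * _ * _]mulrA -prod_gainE //; set g := \prod_(k | _) _.
have g0 : 0 <= g by apply: prodr_ge0 => k _; exact: gain_ge0.
have cg0 : 0 <= c4 R m * g by rewrite mulr_ge0 ?c4_ge0.
apply/ler_addgt0Pr => e e0.
(* The deficit to allow below the supremum; adding 1 covers a zero ratio. *)
have e'0 : 0 < e / (c4 R m * g + 1) by rewrite divr_gt0 // ltr_wpDl.
have [x [hx xsup [r' xr']]] := near_sup _ e'0.
have := trial_approx hd F hn hsub (fun u => xi r' u w) (s r' w) hx.
move=> /le_trans/(_ (best r' _)).
rewrite mem_enum => /(_ isT) /= vge.
have cgx : c4 R m * g * complex.Re (mlform F x) <= v.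
  by rewrite -mulrA; exact: le_trans (ler_wpM2l (c4_ge0 R m) xr') vge.
apply: (@le_trans _ _ (c4 R m * g * (complex.Re (mlform F x) +
    e / (c4 R m * g + 1)))).
  by rewrite ler_wpM2l // -lerBlDr ltW.
rewrite mulrDr lerD // mulrCA -[leRHS]mulr1 ler_wpM2l // ?ltW //.
by rewrite ltr_pdivrMr ?ltr_wpDl // mul1r ltrDl.
Qed.
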